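(* The following algorithm implements $k$-BO-broadcast in any system model enriched with the communication abstraction $k$-SCD-broadcast. - Operation kbo_broadcast$(m)$: kscd_broadcast$(m)$. - When a message set $ms$ is kscd-delivered: for each $m\in ms$ do kbo_deliver$(m)$.
   Context: Model: $n$ asynchronous sequential processes $p_1,\dots,p_n$; up to $n-1$ may crash in a run (a process that crashes is faulty, otherwise it is non-faulty; a process executes its local algorithm correctly until its possible crash). All messages that are broadcast are assumed different. $k$-SCD-broadcast (Set Constrained Delivery) provides the operations kscd_broadcast$(m)$ and kscd_deliver$()$, the latter returning a non-empty set of messages; a process ''kscd-delivers a message $m$'' when it delivers a message set containing $m$. Properties: - KSCD-Validity: if a process kscd-delivers a set containing a message $m$, then $m$ was kscd-broadcast by some process. - KSCD-Integrity: a message is kscd-delivered at most once by each process. - KSCD-Ordering: if a process $p_i$ kscd-delivers first a message $m$ belonging to a set $ms_i$ and later a message $m'$ belonging to a set $ms_i'\ne ms_i$, then no process kscd-delivers first the message $m'$ in some kscd-delivered set $ms_j'$ and later the message $m$ in some kscd-delivered set $ms_j\neq ms_j'$. - KSCD-Termination-1: if a non-faulty process kscd-broadcasts a message $m$, it terminates its kscd-broadcast invocation and kscd-delivers a message set containing $m$. - KSCD-Termination-2: if a process kscd-delivers a message set containing $m$, every non-faulty process kscd-delivers a message set containing $m$. - KSCD-Bounded: no message set kscd-delivered to a process contains more than $k$ messages. $k$-BO-broadcast provides the operations kbo_broadcast$(m)$ and kbo_deliver$()$ (which returns a message). Properties: - KBO-Validity: any message kbo-delivered has been kbo-broadcast by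 a process. - KBO-Integrity: a message is kbo-delivered at most once by each process. - KBO-Bounded: $\mathrm{width}(\mapsto)\le k$. - KBO-Termination-1: if a non-faulty process kbo-broadcasts a message $m$, it terminates its kbo-broadcast invocation and kbo-delivers $m$. - KBO-Termination-2: if a process kbo-delivers a message $m$, every non-faulty process kbo-delivers $m$. Here $m\mapsto_i m'$ if $p_i$ kbo-delivers the message $m$ before it kbo-delivers the message $m'$, and $\mapsto$ is defined as $\bigcap_i\mapsto_i$. The width of a partially ordered set is the cardinality of a maximum antichain.
   Formalization: KBO-Bounded fails literally if a process crashes before delivering anything (its order, hence the intersection, is empty); instead, for every nonempty group of processes, the intersection of their orders, on the messages all of them deliver, is shown to have width at most k. *)

(* Defs.v *)
From mathcomp Require Import all_boot.
From mathcomp Require Import finmap.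
From mathcomp Require Import boolp classical_sets functions cardinality.

Set Implicit Arguments.
Unset Strict Implicit.
Unset Printing Implicit Defensive.

Local Open Scope fset_scope.
Local Open Scope classical_set_scope.
Local Open Scope card_scope.

(* Events of a process at the two broadcast interfaces.  [Inv] and [Ret] are
   the invocation of an operation and the return from it. *)
Inductive action (M : choiceType) : Type :=
  | KboInv of M
  | KboRet of M
  | KboDlv of M
  | KscdInv of M
  | KscdRet of M
  | KscdDlv of {fset M}.
Arguments KboInv {M} m.
Arguments KboRet {M} m.
Arguments KboDlv {M} m.
Arguments KscdInv {M} m.
Arguments KscdRet {M} m.
Arguments KscdDlv {M} ms.

(* [Sys e] stands for any other event of the underlying system (communication
   steps, shared memory accesses, oracle queries, idling, ...). *)
Inductive event (n : nat) (M : choiceType) (E : Type) : Type :=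
  | Act of 'I_n & action M
  | Crash of 'I_n
  | Sys of E.
Arguments Act {n M E} p a.
Arguments Crash {n M E} p.
Arguments Sys {n M E} e.

(* The index is a global time that the processes cannot observe. *)
Definition run (n : nat) (M : choiceType) (E : Type) := nat -> event n M E.

(* A system model is given by the set of its runs. *)
Definition system_model (n : nat) (M : choiceType) (E : Type) :=
  set (run n M E).

Section Runs.
Variables (n : nat) (M : choiceType) (E : Type).
Implicit Types (r : run n M E) (p q : 'I_n) (m : M) (ms : {fset M}).

Definition nonfaulty r p : Prop := forall t, r t <> Crash p.

Definition crash_stop r : Prop :=
  forall p t t' a, r t = Crash p -> r t' = Act p a -> t' < t.

(* At most n - 1 processes crash. *)
Definition crash_prone (S : system_model n M E) : Prop :=
  forall r, S r -> crash_stop r /\ exists p, nonfaulty r p.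

Definition invoked_once (inv : M -> action M) r : Prop :=
  forall t t' p p' m,
    r t = Act p (inv m) -> r t' = Act p' (inv m) -> t = t'.

Definition kscd_delivers r p m : Prop :=
  exists t, exists2 ms, r t = Act p (KscdDlv ms) & m \in ms.

Definition kbo_delivers r p m : Prop :=
  exists t, r t = Act p (KboDlv m).

Record kscd_spec (k : nat) r : Prop := {
  kscd_nonempty : forall t p ms,
    r t = Act p (KscdDlv ms) -> ms != fset0;
  kscd_validity : forall t p ms m,
    r t = Act p (KscdDlv ms) -> m \in ms ->
    exists t', exists2 q, t' < t & r t' = Act q (KscdInv m);
  kscd_integrity : forall t t' p ms ms' m,
    r t = Act p (KscdDlv ms) -> m \in ms ->
    r t' = Act p (KscdDlv ms') -> m \in ms' -> t = t';
  kscd_ordering : forall p m m' t t' ms ms',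
    t < t' ->
    r t = Act p (KscdDlv ms) -> m \in ms ->
    r t' = Act p (KscdDlv ms') -> m' \in ms' ->
    ms' <> ms ->
    ~ exists q u u' us us',
        [/\ u' < u,
            r u' = Act q (KscdDlv us') /\ m' \in us',
            r u = Act q (KscdDlv us) /\ m \in us
          & us <> us'];
  kscd_termination1 : forall t p m,
    nonfaulty r p -> r t = Act p (KscdInv m) ->
    (exists2 t', t < t' & r t' = Act p (KscdRet m)) /\ kscd_delivers r p m;
  kscd_termination2 : forall p m,
    kscd_delivers r p m -> forall q, nonfaulty r q -> kscd_delivers r q m;
  kscd_bounded : forall t p ms,
    r t = Act p (KscdDlv ms) -> #|` ms| <= k
}.

(* The specification is only promised when all broadcast messages differ. *)
Definition enriched_with_kscd (k : nat) (S : system_model n M E) : Prop :=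
  forall r, S r -> invoked_once KscdInv r -> kscd_spec k r.

Definition kbo_before r p m m' : Prop :=
  exists t t',
    [/\ t < t', r t = Act p (KboDlv m) & r t' = Act p (KboDlv m')].

Definition kbo_order r (I : {set 'I_n}) m m' : Prop :=
  forall p, p \in I -> kbo_before r p m m'.

Definition kbo_common r (I : {set 'I_n}) : set M :=
  fun m => forall p, p \in I -> kbo_delivers r p m.

(* Antichain of the strict order [R] on the carrier [D]. *)
Definition antichain (D : set M) (R : M -> M -> Prop) (A : set M) : Prop :=
  A `<=` D /\ forall m m', A m -> A m' -> m <> m' -> ~ R m m'.

(* [w] is the cardinality of a maximum antichain. *)
Definition is_width (D : set M) (R : M -> M -> Prop) (w : nat) : Prop :=
  (exists2 A, antichain D R A & A #= `I_w) /\
  (forall A, antichain D R A -> A #<= `I_w).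

(* [kbo_order r I] intersects the local orders of the processes of [I].  With
   [I] the set of all processes it is the intersection of all local orders.
   A process that crashes early, however, does not order the messages it never
   delivered: if some process delivers nothing, the intersection over all
   processes is empty, whatever the others do.  Hence an intersection is taken
   as an order on the messages that all processes involved deliver, and the
   bound is required of every group [I]; taking for [I] the non-faulty
   processes bounds the width on the set of all delivered messages (they
   deliver every message that some process delivers).  If all processes
   deliver the same messages, the case of all processes implies the others. *)
Record kbo_spec (k : nat) r : Prop := {
  kbo_validity : forall t p m,
    r t = Act p (KboDlv m) ->
    exists t', exists2 q, t' < t & r t' = Act q (KboInv m);
  kbo_integrity : forall t t' p m,
    r t = Act p (KboDlv m) -> r t' = Act p (KboDlv m) -> t = t';
  kbo_bounded : forall I : {set 'I_n}, I != finset.set0 ->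
    exists2 w, is_width (kbo_common r I) (kbo_order r I) w & w <= k;
  kbo_termination1 : forall t p m,
    nonfaulty r p -> r t = Act p (KboInv m) ->
    (exists2 t', t < t' & r t' = Act p (KboRet m)) /\ kbo_delivers r p m;
  kbo_termination2 : forall p m,
    kbo_delivers r p m -> forall q, nonfaulty r q -> kbo_delivers r q m
}.

End Runs.

(* Control point of the operation kbo_broadcast: not invoked; about to call
   kscd_broadcast; waiting for kscd_broadcast to return; about to return. *)
Inductive op_phase (M : choiceType) : Type :=
  | Idle
  | Calling of M
  | Waiting of M
  | Returning of M.
Arguments Idle {M}.
Arguments Calling {M} m.
Arguments Waiting {M} m.
Arguments Returning {M} m.

(* [todo] holds the messages that the current delivery handler still has to
   kbo-deliver; it is empty when no handler is running. *)
Record lstate (M : choiceType) : Type := LState {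
  phase : op_phase M;
  todo : {fset M}
}.

(* The handler may run while kbo_broadcast waits.  Since the process is
   sequential, a message set is kscd-delivered to it only when the handler of
   the previous one is over; the loop takes the messages in any order. *)
Inductive lstep (M : choiceType) :
    lstate M -> action M -> lstate M -> Prop :=
  | step_kbo_inv q m :
      lstep (LState Idle q) (KboInv m) (LState (Calling m) q)
  | step_kscd_inv q m :
      lstep (LState (Calling m) q) (KscdInv m) (LState (Waiting m) q)
  | step_kscd_ret q m :
      lstep (LState (Waiting m) q) (KscdRet m) (LState (Returning m) q)
  | step_kbo_ret q m :
      lstep (LState (Returning m) q) (KboRet m) (LState Idle q)
  | step_kscd_dlv c ms :
      lstep (LState c fset0) (KscdDlv ms) (LState c ms)
  | step_kbo_dlv c (q : {fset M}) m :
      m \in q -> lstep (LState c q) (KboDlv m) (LState c (q `\ m)%fset).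

Section Executions.
Variables (n : nat) (M : choiceType) (E : Type).
Implicit Types (r : run n M E) (st : nat -> 'I_n -> lstate M) (p q : 'I_n).

Definition follows_code r st : Prop :=
  (forall p, st 0 p = LState Idle fset0) /\
  forall t, match r t with
    | Act p a => lstep (st t p) a (st t.+1 p) /\
                 (forall q, q <> p -> st t.+1 q = st t q)
    | _ => st t.+1 = st t
    end.

(* A non-faulty process eventually takes its next step in the operation and in
   the handler; a process that crashes may stop anywhere, in particular in the
   middle of the loop. *)
Definition makes_progress r st : Prop :=
  forall p, nonfaulty r p -> forall t,
    [/\ forall m, phase (st t p) = Calling m ->
          exists2 t', t <= t' & r t' = Act p (KscdInv m),
        forall m, phase (st t p) = Returning m ->
          exists2 t', t <= t' & r t' = Act p (KboRet m)
      & todo (st t p) != fset0 ->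
          exists t', exists2 m, t <= t' & r t' = Act p (KboDlv m)].

(* The runs in which all processes execute the algorithm. *)
Definition kbo_from_kscd : set (run n M E) :=
  fun r => exists2 st, follows_code r st & makes_progress r st.

(* In the system model [S], the algorithm with runs [alg] implements
   k-BO-broadcast (all broadcast messages being different). *)
Definition implements_kbo (k : nat) (S : system_model n M E)
    (alg : set (run n M E)) : Prop :=
  forall r, S r -> alg r -> invoked_once KboInv r -> kbo_spec k r.

End Executions.

(* Main.v *)
Require Import Defs.
From mathcomp Require Import all_boot.
From mathcomp Require Import finmap.
From mathcomp Require Import boolp classical_sets cardinality.

(** Let [rank p m] be the time at which [p] kscd-delivers the set containing
    [m].  KSCD-Ordering says that two ranks never order two messages in
    opposite ways, so in a finite antichain [F] the messages [a] and [b] that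
    minimise and maximise the sum over [p] of [rank p] are extremal for every
    single rank.  As [a] is not before [b] at every process, some [p] has
    [rank p b <= rank p a]; then all of [F] has the same rank at [p], i.e. [F]
    lies in one set kscd-delivered by [p] and has at most [k] elements. *)

Set Implicit Arguments.
Unset Strict Implicit.
Unset Printing Implicit Defensive.

Local Open Scope classical_set_scope.
Local Open Scope card_scope.

(** * Width of an order from its finite antichains *)

Section Width.
Variable M : choiceType.

Lemma antichain_sub (D : set M) (R : M -> M -> Prop) (A B : set M) :
  B `<=` A -> antichain D R A -> antichain D R B.
Proof.
move=> BA [AD Aanti]; split; first exact: subset_trans AD.
by move=> m m' /BA Am /BA Am'; apply: Aanti.
Qed.

(** An infinite antichain would contain a finite one with [k.+1] elements, so every antichain is
    finite of size at most [k]. The sizes that occur are bounded and include 0 (empty antichain),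
    hence have a maximum. *)
Lemma bounded_width (D : set M) (R : M -> M -> Prop) (k : nat) :
  (forall F : {fset M}, antichain D R [set` F] -> #|` F| <= k) ->
  exists2 w, is_width D R w & w <= k.
Proof.
move=> Fle.
have card_anti A : antichain D R A -> exists2 w, A #= `I_w & w <= k.
  move=> antiA; have [finA | infA] := pselect (finite_set A).
    have [F AF] := finite_fsetP.1 finA; exists #|` F|.
      by rewrite AF; exact/card_eq_fsetP.
    by apply: Fle; rewrite -AF.
  have [F FA ltkF] := infinite_set_fset k.+1 infA.
  by have := leq_trans ltkF (Fle F (antichain_sub FA antiA)); rewrite ltnn.
pose P w := `[< exists2 A, antichain D R A & A #= `I_w >].
have exP : exists w, P w.
  exists 0; apply/asboolP; exists set0; first by split.
  by rewrite II0 card_eq0.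
have leP w : P w -> w <= k.
  move=> /asboolP[A antiA Aw]; have [w' Aw' lew'] := card_anti A antiA.
  suff -> : w = w' by [].
  by apply/card_eq_II; apply: card_eq_trans Aw'; rewrite card_eq_sym.
case: (ex_maxnP exP leP) => w /asboolP exw maxw.
exists w; last by apply: leP; apply/asboolP.
split=> // A antiA; have [w' Aw' _] := card_anti A antiA.
rewrite (card_le_eql Aw') card_le_II; apply: maxw.
by apply/asboolP; exists A.
Qed.

End Width.

Lemma common_rank (J : finType) (M : choiceType) (I : {set J}) (F : {fset M})
    (rank : J -> M -> nat) :
    I != finset.set0 ->
    (forall p q m m', p \in I -> q \in I -> m \in F -> m' \in F ->
       rank p m < rank p m' -> rank q m <= rank q m') ->
    (forall m m', m \in F -> m' \in F -> m <> m' ->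
       exists2 p, p \in I & rank p m' <= rank p m) ->
  exists2 p, p \in I & {in F &, forall m m', rank p m = rank p m'}.
Proof.
move=> /set0Pn[p0 Ip0] compat anti.
have [-> | /fset0Pn[x0 Fx0]] := eqVneq F fset0; first by exists p0.
pose weight (m : F) := \sum_(p in I) rank p (val m).
(* A strict reversal at [p] forces, by [compat], weak reversals at all other members of [I], so the
   sums would be strictly reversed too. *)
have rank_le p m m' : p \in I -> weight m <= weight m' ->
    rank p (val m) <= rank p (val m').
  move=> Ip; apply: contraTT; rewrite -!ltnNge => ltp.
  rewrite /weight (bigD1 p) //= [ltnRHS](bigD1 p) //= -addSn leq_add //.
  by apply: leq_sum => q /andP[Iq _]; apply: compat ltp; rewrite ?fsvalP.
case: (arg_minnP (P := predT) (i0 := [` Fx0]%fset) weight isT) => a _ mina.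
case: (arg_maxnP (P := predT) (i0 := [` Fx0]%fset) weight isT) => b _ maxb.
have [p Ip leba] : exists2 p, p \in I & rank p (val b) <= rank p (val a).
  (* If the extremal messages coincide, any member of [I] serves. *)
  have [-> | /eqP neq_ab] := eqVneq a b; first by exists p0.
  by apply: anti; rewrite ?fsvalP // => /val_inj.
have ranka (m : F) : rank p (val m) = rank p (val a).
  apply/eqP; rewrite eqn_leq (rank_le p a m) ?mina // andbT.
  by apply: leq_trans leba; apply: rank_le => //; apply: maxb.
by exists p => // m m' Fm Fm'; rewrite (ranka [` Fm]%fset) (ranka [` Fm']%fset).
Qed.

(** * Inversion of single local steps *)

Section Steps.
Variable M : choiceType.
Implicit Types (s : lstate M) (a : action M) (m : M).

Lemma lstep_todo s a s' : lstep s a s' ->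
  todo s' = match a with
            | KscdDlv ms => ms
            | KboDlv m => (todo s `\ m)%fset
            | _ => todo s
            end.
Proof. by case. Qed.

Lemma lstep_kscd_dlv s ms s' : lstep s (KscdDlv ms) s' -> todo s = fset0.
Proof. by move E: (KscdDlv ms) => a sas'; case: sas' E. Qed.

Lemma lstep_kbo_dlv s m s' : lstep s (KboDlv m) s' -> m \in todo s.
Proof. by move E: (KboDlv m) => a sas'; case: sas' E => //= c q m' qm' [->]. Qed.

Lemma lstep_kbo_inv s m s' : lstep s (KboInv m) s' -> phase s' = Calling m.
Proof. by move E: (KboInv m) => a sas'; case: sas' E => //= q m' [->]. Qed.

Lemma lstep_kscd_inv s m s' : lstep s (KscdInv m) s' -> phase s = Calling m.
Proof. by move E: (KscdInv m) => a sas'; case: sas' E => //= q m' [->]. Qed.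

Lemma lstep_kscd_ret s m s' : lstep s (KscdRet m) s' -> phase s' = Returning m.
Proof. by move E: (KscdRet m) => a sas'; case: sas' E => //= q m' [->]. Qed.

Lemma lstep_calling s a s' m : lstep s a s' -> phase s' = Calling m ->
  a = KboInv m \/ phase s = Calling m /\ a <> KscdInv m.
Proof. by case=> //= [q m' [->] | c ms -> | c q m' _ ->]; [left | right | right]. Qed.

End Steps.

(** * Origin and fate of messages in a run of the algorithm *)

Section Algorithm.
Variables (n : nat) (M : choiceType) (E : Type).
Variables (r : run n M E) (st : nat -> 'I_n -> lstate M).
Hypothesis code : follows_code r st.
Implicit Types (p q : 'I_n) (m : M) (ms : {fset M}).

Lemma follows_act t p a : r t = Act p a -> lstep (st t p) a (st t.+1 p).
Proof. by move=> rt; have := code.2 t; rewrite rt => -[]. Qed.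

Lemma follows_cases t p :
  (exists2 a, r t = Act p a & lstep (st t p) a (st t.+1 p)) \/
  (forall a, r t <> Act p a) /\ st t.+1 p = st t p.
Proof.
have := code.2 t; case: (r t) => [q a | q | e].
- move=> [stepq other]; have [-> | /eqP neq_pq] := eqVneq p q.
    by left; exists a.
  by right; split=> [b [/esym] // | ]; exact: other.
- by move->; right.
- by move->; right.
Qed.

(** The phase [Calling m] is entered only by [KboInv m] and left by [KscdInv m]. The last clause is
    what later excludes a second call for one invocation. *)
Lemma calling_origin t p m : phase (st t p) = Calling m ->
  exists s, [/\ s < t, r s = Act p (KboInv m) &
    forall u, s < u < t -> r u <> Act p (KscdInv m)].
Proof.
elim: t => [|t IHt]; first by rewrite code.1.
have keep : phase (st t p) = Calling m -> r t <> Act p (KscdInv m) ->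
    exists s, [/\ s < t.+1, r s = Act p (KboInv m) &
      forall u, s < u < t.+1 -> r u <> Act p (KscdInv m)].
  move=> /IHt[s [lt_st rs noinv]] rt; exists s; split=> // [|u].
    exact: ltnW.
  rewrite ltnS [u <= t]leq_eqVlt => /andP[lt_su /predU1P[-> // | lt_ut]].
  by apply: noinv; rewrite lt_su.
case: (follows_cases t p) => [[a rt stepa] | [noact ->]]; last first.
  by move=> ph; apply: keep.
case/(lstep_calling stepa) => [eq_a | [ph neq_a]].
  exists t; split; rewrite -?eq_a // => u.
  by rewrite ltnS => /andP[lt_tu le_ut]; move: (leq_trans lt_tu le_ut); rewrite ltnn.
by apply: keep => //; rewrite rt => -[].
Qed.

Lemma todo_origin t p m : m \in todo (st t p) ->
  exists s, [/\ s < t, exists2 ms, r s = Act p (KscdDlv ms) & m \in ms &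
    forall u, s < u < t ->
      (forall ms, r u <> Act p (KscdDlv ms)) /\ r u <> Act p (KboDlv m)].
Proof.
elim: t => [|t IHt]; first by rewrite code.1.
have keep : m \in todo (st t p) ->
    (forall ms, r t <> Act p (KscdDlv ms)) -> r t <> Act p (KboDlv m) ->
    exists s, [/\ s < t.+1, exists2 ms, r s = Act p (KscdDlv ms) & m \in ms &
      forall u, s < u < t.+1 ->
        (forall ms, r u <> Act p (KscdDlv ms)) /\ r u <> Act p (KboDlv m)].
  move=> /IHt[s [lt_st rs nodlv]] rt rt'; exists s; split=> // [|u].
    exact: ltnW.
  rewrite ltnS [u <= t]leq_eqVlt => /andP[lt_su /predU1P[-> // | lt_ut]].
  by apply: nodlv; rewrite lt_su.
case: (follows_cases t p) => [[a rt stepa] | [noact ->]]; last first.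
  by move=> ph; apply: keep.
rewrite (lstep_todo stepa).
case: a rt stepa => [m'|m'|m'|m'|m'|ms] rt stepa;
  try by move=> td; apply: keep => // [ms|]; rewrite rt.
- rewrite in_fsetD1 => /andP[/eqP neq_m td].
  by apply: keep => // [ms|]; rewrite rt // => -[] /esym.
- move=> ms_m; exists t; split=> // [|u]; first by exists ms.
  by rewrite ltnS => /andP[lt_tu le_ut]; move: (leq_trans lt_tu le_ut); rewrite ltnn.
Qed.

Lemma kbo_dlv_origin t p m : r t = Act p (KboDlv m) ->
  exists s, [/\ s < t, exists2 ms, r s = Act p (KscdDlv ms) & m \in ms &
    forall u, s < u < t ->
      (forall ms, r u <> Act p (KscdDlv ms)) /\ r u <> Act p (KboDlv m)].
Proof. by move=> /follows_act /lstep_kbo_dlv; exact: todo_origin. Qed.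

Lemma kbo_delivers_kscd p m : kbo_delivers r p m -> kscd_delivers r p m.
Proof. by case=> t /kbo_dlv_origin[s [_ rs _]]; exists s. Qed.

Lemma kscd_inv_origin t p m : r t = Act p (KscdInv m) ->
  exists s, [/\ s < t, r s = Act p (KboInv m) &
    forall u, s < u < t -> r u <> Act p (KscdInv m)].
Proof. by move=> /follows_act /lstep_kscd_inv; exact: calling_origin. Qed.

(** Unlocks the promise of [enriched_with_kscd]. Two calls for [m] stem from the same [KboInv m],
    and the earlier call would lie between that invocation and the later call. *)
Lemma kscd_invoked_once : invoked_once KboInv r -> invoked_once KscdInv r.
Proof.
move=> once.
suff nolt t t' p p' m : r t = Act p (KscdInv m) -> r t' = Act p' (KscdInv m) ->
    ~ t < t'.
  move=> t t' p p' m rt rt'.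
  by case: (ltngtP t t') => // [/(nolt _ _ _ _ _ rt rt') | /(nolt _ _ _ _ _ rt' rt)].
move=> rt rt' lt_tt'.
have [s [lt_st rs _]] := kscd_inv_origin rt.
have [s' [_ rs' noinv]] := kscd_inv_origin rt'.
have eq_s := once _ _ _ _ _ rs rs'; subst s'.
move: rs'; rewrite rs => -[eq_p].
by apply: (noinv t); rewrite ?lt_st -?eq_p.
Qed.

Lemma todo_persists t t' p m : t <= t' -> m \in todo (st t p) ->
  kbo_delivers r p m \/
  m \in todo (st t' p) /\ (todo (st t' p) `<=` todo (st t p))%fset.
Proof.
move=> /subnKC <- td; elim: (t' - t) => {t'} [|d [|[mtd sub]]].
- by rewrite addn0; right.
- by left.
rewrite addnS; case: (follows_cases (t + d) p) => [[a rt stepa] | [_ ->]];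
  last by right.
rewrite (lstep_todo stepa); case: a rt stepa => [m'|m'|m'|m'|m'|ms] rt stepa;
  try by right.
- have [eq_m | neq_m] := eqVneq m m'; first by left; exists (t + d); rewrite eq_m.
  right; rewrite in_fsetD1 neq_m; split=> //.
  exact: fsubset_trans (fsubD1set _ _) sub.
- by move: mtd; rewrite (lstep_kscd_dlv stepa) in_fset0.
Qed.

Lemma todo_delivered p m t : makes_progress r st -> nonfaulty r p ->
  m \in todo (st t p) -> kbo_delivers r p m.
Proof.
move=> progress okp; have [N] := ubnP #|` todo (st t p)|.
elim: N t => // N IHN t; rewrite ltnS => leN td.
have [_ _ prog] := progress p okp t.
have [|t' [m' le_tt' rt']] := prog; first by apply/fset0Pn; exists m.
have [// | [mtd sub]] := todo_persists le_tt' td.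
have [eq_m | neq_m] := eqVneq m m'; first by exists t'; rewrite eq_m.
have step' := follows_act rt'.
apply: (IHN t'.+1); rewrite (lstep_todo step'); last by rewrite in_fsetD1 neq_m.
apply: leq_trans leN; apply: leq_trans (fsubset_leq_card sub).
by rewrite [ltnRHS](cardfsD1 m') (lstep_kbo_dlv step').
Qed.

Lemma kscd_delivers_kbo p m : makes_progress r st -> nonfaulty r p ->
  kscd_delivers r p m -> kbo_delivers r p m.
Proof.
move=> progress okp [t [ms rt ms_m]].
by apply: (todo_delivered (t := t.+1)) => //; rewrite (lstep_todo (follows_act rt)).
Qed.

(** * Consequences of the k-SCD specification *)

Variable k : nat.
Hypothesis spec : kscd_spec k r.

Lemma kbo_dlv_unique t t' p m :
  r t = Act p (KboDlv m) -> r t' = Act p (KboDlv m) -> t = t'.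
Proof.
suff nolt u u' : r u = Act p (KboDlv m) -> r u' = Act p (KboDlv m) -> ~ u < u'.
  move=> rt rt'.
  by case: (ltngtP t t') => // [/(nolt _ _ rt rt') | /(nolt _ _ rt' rt)].
move=> ru ru' lt_uu'.
have [s [lt_su [ms rs ms_m] _]] := kbo_dlv_origin ru.
have [s' [_ [ms' rs' ms'_m] nodlv]] := kbo_dlv_origin ru'.
have eq_s := kscd_integrity spec rs ms_m rs' ms'_m; subst s'.
by case: (nodlv u) => //; rewrite lt_su.
Qed.

(** The rank of [m] at [p]. The default 0 stands for a message never kscd-delivered at [p]; by
    KSCD-Integrity the time is otherwise unique. *)
Definition kscd_time p m : nat :=
  xget 0 [set t | exists2 ms, r t = Act p (KscdDlv ms) & m \in ms].

Lemma kscd_timeE t p m ms :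
  r t = Act p (KscdDlv ms) -> m \in ms -> kscd_time p m = t.
Proof.
move=> rt ms_m; apply: xget_unique; first by exists ms.
by move=> t' [ms' rt' ms'_m]; apply: (kscd_integrity spec rt' ms'_m rt ms_m).
Qed.

Lemma kscd_timeP p m : kscd_delivers r p m ->
  exists2 ms, r (kscd_time p m) = Act p (KscdDlv ms) & m \in ms.
Proof. by move=> [t [ms rt ms_m]]; exists ms; rewrite ?(kscd_timeE rt ms_m). Qed.

Lemma kscd_time_compat p q m m' :
  kscd_delivers r p m -> kscd_delivers r p m' ->
  kscd_delivers r q m -> kscd_delivers r q m' ->
  kscd_time p m < kscd_time p m' -> kscd_time q m <= kscd_time q m'.
Proof.
(* KSCD-Ordering speaks of distinct sets only; messages in the same set would have equal times. *)
have neq_sets p' x x' ms ms' : r (kscd_time p' x) = Act p' (KscdDlv ms) ->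
    x \in ms -> kscd_time p' x < kscd_time p' x' -> x' \in ms' -> ms' <> ms.
  move=> rx ms_x lt_xx' ms'_x' eq_ms; move: ms'_x'; rewrite eq_ms => ms_x'.
  by move: lt_xx'; rewrite (kscd_timeE rx ms_x') ltnn.
move=> /kscd_timeP[ms rm ms_m] /kscd_timeP[ms' rm' ms'_m'].
move=> /kscd_timeP[us qm us_m] /kscd_timeP[us' qm' us'_m'] lt_p.
rewrite leqNgt; apply/negP => lt_q.
apply: (kscd_ordering spec lt_p rm ms_m rm' ms'_m' (neq_sets _ _ _ _ _ rm ms_m lt_p ms'_m')).
exists q, (kscd_time q m), (kscd_time q m'), us, us'; split=> //.
exact: neq_sets qm' us'_m' lt_q us_m.
Qed.

(** Handlers do not overlap: all of one set is kbo-delivered before the next set is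
    kscd-delivered. *)
Lemma kscd_time_kbo_before p m m' :
  kbo_delivers r p m -> kbo_delivers r p m' ->
  kscd_time p m < kscd_time p m' -> kbo_before r p m m'.
Proof.
move=> [t rt] [t' rt'] lt_s.
have [s [lt_st [ms rs ms_m] nodlv]] := kbo_dlv_origin rt.
have [s' [lt_st' [ms' rs' ms'_m'] _]] := kbo_dlv_origin rt'.
move: lt_s; rewrite (kscd_timeE rs ms_m) (kscd_timeE rs' ms'_m') => lt_s.
exists t, t'; split=> //; rewrite ltnNge; apply/negP => le_t't.
have lt_s't : s' < t := leq_trans lt_st' le_t't.
by have [/(_ ms')] := nodlv s' (introT andP (conj lt_s lt_s't)).
Qed.

Lemma antichain_leq (I : {set 'I_n}) (F : {fset M}) : I != finset.set0 ->
  antichain (kbo_common r I) (kbo_order r I) [set` F] -> #|` F| <= k.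
Proof.
move=> I0 [common anti].
have kbo p m : p \in I -> m \in F -> kbo_delivers r p m.
  by move=> Ip Fm; apply: common.
have kscd p m (Ip : p \in I) (Fm : m \in F) := kbo_delivers_kscd (kbo p m Ip Fm).
have [p Ip same] : exists2 p, p \in I &
    {in F &, forall m m', kscd_time p m = kscd_time p m'}.
  apply: common_rank => // [p q m m' Ip Iq Fm Fm' | m m' Fm Fm' neq_m].
    by apply: kscd_time_compat; apply: kscd.
  (* If [m] had the smaller time at every process of [I], all of them would kbo-deliver it first,
     against the antichain property. *)
  apply: contra_notP (anti m m' Fm Fm' neq_m) => later p Ip.
  apply: kscd_time_kbo_before; try exact: kbo.
  by rewrite ltnNge; apply/negP => le_m; apply: later; exists p.
have [-> | /fset0Pn[m Fm]] := eqVneq F fset0; first by rewrite cardfs0.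
have [ms rm ms_m] := kscd_timeP (kscd p m Ip Fm).
apply: leq_trans (kscd_bounded spec rm); apply: fsubset_leq_card.
apply/fsubsetP => m' Fm'; have [ms' rm' ms'_m'] := kscd_timeP (kscd p m' Ip Fm').
(* Equal times mean the same event, hence the same delivered set. *)
by move: rm'; rewrite (same m' m) // rm => -[->].
Qed.

End Algorithm.

Theorem theorem3 (n k : nat) (M : choiceType) (E : Type)
    (S : system_model n M E)
    (hcrash : crash_prone S)
    (hkscd : enriched_with_kscd k S) :
  implements_kbo k S (@kbo_from_kscd n M E).
Proof.
move=> r Sr [st code progress] once.
have spec := hkscd r Sr (kscd_invoked_once code once).
split.
- move=> t p m /(kbo_dlv_origin code)[s [lt_st [ms rs ms_m] _]].
  have [u [q lt_us ru]] := kscd_validity spec rs ms_m.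
  have [v [lt_vu rv _]] := kscd_inv_origin code ru.
  by exists v, q; rewrite // (ltn_trans lt_vu) // (ltn_trans lt_us).
- by move=> t t' p m; apply: kbo_dlv_unique code _ spec _ _ _ _.
- by move=> I I0; apply: bounded_width => F; apply: antichain_leq code _ spec _ _ I0.
- move=> t p m okp rt.
  (* At [t.+1], just after the invocation, the phase is [Calling m]; likewise [v.+1] below is the
     point where it becomes [Returning m]. *)
  have [call _ _] := progress p okp t.+1.
  have [u lt_tu ru] := call m (lstep_kbo_inv (follows_act code rt)).
  have [[v lt_uv rv] dlv] := kscd_termination1 spec okp ru.
  split; last exact: kscd_delivers_kbo code _ _ progress okp dlv.
  have [_ ret _] := progress p okp v.+1.
  have [w lt_vw rw] := ret m (lstep_kscd_ret (follows_act code rv)).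
  by exists w; rewrite // (leq_trans lt_tu) // ltnW // (ltn_trans lt_uv).
- move=> p m /(kbo_delivers_kscd code) dlv q okq.
  exact: kscd_delivers_kbo code _ _ progress okq (kscd_termination2 spec dlv okq).
Qed.
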